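(* Let $(W,S)$ be a finite Coxeter system (i.e. $W$ is finite), $R$ a fusion ring with basis $\mathfrak B$, and $R\Lambda_S$ a geometric $R$-realisation of $(W,S)$ with unfolded Coxeter system $(\check W,\check S)$. Let $\mathcal A$ and $\check{\mathcal A}$ be the hyperplane systems of $W$ acting on $\mathrm{Hom}_R(R\Lambda_S,\mathbb R)$ and of $\check W$ acting on $\mathrm{Hom}_{\mathbb Z}(R\Lambda_S,\mathbb R)$. Then $$\mathcal A=\{\check H\cap\mathrm{Hom}_R(R\Lambda_S,\mathbb R)\mid\check H\in\check{\mathcal A}\}.$$
   Context: Coxeter systems: $S$ is a finite set, $(m_{s,t})_{s,t\in S}$ is a symmetric matrix with $m_{s,s}=1$ and $m_{s,t}\in\{2,3,\dots,\infty\}$ for $s\ne t$, and $W=\langle S\mid (st)^{m_{s,t}}=1 \text{ whenever } m_{s,t}<\infty\rangle$. Rings are unital and associative, not necessarily commutative. Fusion ring: a ring $R$, free as a $\mathbb Z$-module on a finite basis $\mathfrak B=\{b_1,\dots,b_n\}$ with $b_1=1$, such that every product $b_jb_k=\sum_i {}_jc_{k,i}b_i$ is non-zero with all ${}_jc_{k,i}\in\mathbb Z_{\ge0}$, together with an involution $b_j\mapsto b_j^*=b_{j^*}$ of $\mathfrak B$ whose $\mathbb Z$-linear extension $*:R\to R$ satisfies $(rs)^*=s^*r^*$, and such that the coefficient of $1$ in $b_jb_k$ is $1$ if $k=j^*$ and $0$ otherwise. $R_{\ge0}$ is the set of non-negative integral combinations of $\mathfrak B$. $\mathrm{FPdim}(b_j)$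 is the largest non-negative real (Frobenius–Perron) eigenvalue of the matrix $({}_jc_{k,\ell})_{k,\ell}$; extended $\mathbb Z$-linearly, $\mathrm{FPdim}:R\to\mathbb R$ is a ring homomorphism, with $\mathrm{FPdim}(b)\ge1$ for $b\in\mathfrak B$ and $\mathrm{FPdim}(r^* )=\mathrm{FPdim}(r)$. Geometric $R$-realisation: $R\Lambda_S=\bigoplus_{s\in S}R\alpha_s$ is the free left $R$-module, with a $\mathbb Z$-bilinear form $B_R:R\Lambda_S\times R\Lambda_S\to R$ such that $B_R(x\alpha_s,y\alpha_t)=y\,r_{s,t}\,x^*$ where $r_{s,t}=B_R(\alpha_s,\alpha_t)$ and $r_{s,s}=2$, such that $s(v)=v-B_R(\alpha_s,v)\alpha_s$ ($s\in S$) induces a well-defined left $R$-linear action of $W$ on $R\Lambda_S$; and, for $s\ne t$: $-r_{s,t}\in R_{\ge0}$, $r_{t,s}=r_{s,t}^*$, $\mathrm{FPdim}(r_{s,t})=-2\cos(\pi/m_{s,t})$ if $m_{s,t}<\infty$, and $\mathrm{FPdim}(r_{s,t})\le-2$ if $m_{s,t}=\infty$. Unfolded Coxeter system $(\check W,\check S)$: $\check S=\mathfrak B\times S$. For $(b_i,s),(b_j,t)\in\check S$ define integers $\check r_{(b_i,s),(b_j,t)}$ by: $2$ if $(b_i,s)=(b_j,t)$, $0$ if $s=t$ and $i\ne j$, and for $s\neq t$ by $b_j r_{s,t}=\sum_i \check r_{(b_i,s),(b_j,t)}b_i$. Distinct vertices are joined by an edge of the Coxeter graph iff $\check r\ne0$;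 the label is $3$ if $\check r=-1$ and $\infty$ if $\check r\le-2$ (no edge means $m=2$). $\mathbb Z\Lambda_{\check S}=\bigoplus_{(b,s)}\mathbb Z\alpha_{b,s}$ carries the symmetric form $B_{\mathbb Z}$ with matrix $\check r$, and $\check W$ acts by $(b,s)(v)=v-B_{\mathbb Z}(\alpha_{b,s},v)\alpha_{b,s}$. $\mathbb Z\Lambda_{\check S}$ is identified with $R\Lambda_S$ via $\alpha_{b,s}\leftrightarrow b\alpha_s$, so $\check W$ acts on $R\Lambda_S$ $\mathbb Z$-linearly. Dual spaces and hyperplane systems: $\mathbb R$ is a left $R$-module via $\mathrm{FPdim}$. $W$ acts on $\mathrm{Hom}_R(R\Lambda_S,\mathbb R)\subseteq\mathrm{Hom}_{\mathbb Z}(R\Lambda_S,\mathbb R)$ and $\check W$ acts on $\mathrm{Hom}_{\mathbb Z}(R\Lambda_S,\mathbb R)$ by $(w\cdot Z)(v)=Z(w^{-1}v)$. $\mathcal A$ is the set of fixed hyperplanes in $\mathrm{Hom}_R(R\Lambda_S,\mathbb R)$ of the elements $wsw^{-1}$ ($w\in W$, $s\in S$), and $\check{\mathcal A}$ is the set of fixed hyperplanes in $\mathrm{Hom}_{\mathbb Z}(R\Lambda_S,\mathbb R)$ of the elements $\check w\check s\check w^{-1}$ ($\check w\in\check W$, $\check s\in\check S$). *)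

(* Defs.v *)
From HB Require Import structures.
From mathcomp Require Import all_boot all_order all_algebra generic_quotient.
From mathcomp Require Import all_classical all_reals all_analysis.
From mathcomp Require Import ring zify.

Set Implicit Arguments.
Unset Strict Implicit.
Unset Printing Implicit Defensive.

Import Order.TTheory GRing.Theory Num.Theory.
Local Open Scope classical_set_scope.
Local Open Scope ring_scope.

(* [Some k] stands for the finite label k and [None] for infinity. *)
Record coxeterMatrix (S : finType) := CoxeterMatrix {
  cox_m :> S -> S -> option nat;
  cox_m_sym : forall s t, cox_m s t = cox_m t s;
  cox_m_diag : forall s, cox_m s s = Some 1%N;
  cox_m_off : forall s t k, s != t -> cox_m s t = Some k -> (2 <= k)%N }.

(* The congruence on words in S generated by (st)^k ~ empty word for
   m_{s,t} = k finite.  As m_{s,s} = 1, each generator is its own inverse, so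
   the quotient monoid is the group presented by the same relations. *)
Inductive cox_cong (S : finType) (m : coxeterMatrix S) :
    seq S -> seq S -> Prop :=
  | Cox_refl u : cox_cong m u u
  | Cox_sym u v : cox_cong m u v -> cox_cong m v u
  | Cox_trans u v w : cox_cong m u v -> cox_cong m v w -> cox_cong m u w
  | Cox_cat u u' v v' :
      cox_cong m u u' -> cox_cong m v v' -> cox_cong m (u ++ v) (u' ++ v')
  | Cox_rel s t k :
      m s t = Some k -> cox_cong m (flatten (nseq k [:: s; t])) [::].

Definition cox_rel (S : finType) (m : coxeterMatrix S) : rel (seq S) :=
  fun u v => `[< cox_cong m u v >].

Lemma cox_rel_refl (S : finType) (m : coxeterMatrix S) : reflexive (cox_rel m).
Proof. by move=> u; apply/asboolP; exact: Cox_refl. Qed.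

Lemma cox_rel_sym (S : finType) (m : coxeterMatrix S) : symmetric (cox_rel m).
Proof. by move=> u v; apply/asboolP/asboolP; exact: Cox_sym. Qed.

Lemma cox_rel_trans (S : finType) (m : coxeterMatrix S) :
  transitive (cox_rel m).
Proof.
by move=> v u w /asboolP uv /asboolP vw; apply/asboolP; apply: Cox_trans uv vw.
Qed.

Canonical cox_equiv (S : finType) (m : coxeterMatrix S) :=
  EquivRel (cox_rel m) (cox_rel_refl m) (cox_rel_sym m) (@cox_rel_trans S m).

Definition coxGroup (S : finType) (m : coxeterMatrix S) :=
  {eq_quot (cox_equiv m)}%qT.

HB.instance Definition _ (S : finType) (m : coxeterMatrix S) :=
  Choice.on (coxGroup m).

Definition cox_word (S : finType) (m : coxeterMatrix S) (u : seq S) :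
  coxGroup m := (\pi_{eq_quot (cox_equiv m)} u)%qT.
Definition cox_repr (S : finType) (m : coxeterMatrix S) (w : coxGroup m) :
  seq S := repr w.

Lemma cox_reprK (S : finType) (m : coxeterMatrix S) (w : coxGroup m) :
  cox_word m (cox_repr w) = w.
Proof. exact: reprK. Qed.

Lemma cox_wordP (S : finType) (m : coxeterMatrix S) u v :
  cox_word m u = cox_word m v <-> cox_cong m u v.
Proof.
split=> [/eqP|uv]; first by rewrite /cox_word eqmodE => /asboolP.
by apply/eqP; rewrite /cox_word eqmodE; apply/asboolP.
Qed.

Lemma cox_repr_word (S : finType) (m : coxeterMatrix S) u :
  cox_cong m (cox_repr (cox_word m u)) u.
Proof. by apply/cox_wordP; rewrite cox_reprK. Qed.

Lemma cox_cong_rev (S : finType) (m : coxeterMatrix S) u v :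
  cox_cong m u v -> cox_cong m (rev u) (rev v).
Proof.
elim=> {u v}.
- by move=> u; exact: Cox_refl.
- by move=> u v _; exact: Cox_sym.
- by move=> u v w _ uv _; exact: Cox_trans.
- by move=> u u' v v' _ uu _ vv; rewrite !rev_cat; exact: Cox_cat.
move=> s t k mst.
have -> : rev (flatten (nseq k [:: s; t])) = flatten (nseq k [:: t; s]).
  by rewrite rev_flatten map_nseq rev_nseq.
by apply: Cox_rel; rewrite cox_m_sym.
Qed.

Lemma cox_cong_revl (S : finType) (m : coxeterMatrix S) u :
  cox_cong m (rev u ++ u) [::].
Proof.
elim: u => [|s u IHu]; first exact: Cox_refl.
have -> : rev (s :: u) ++ s :: u = rev u ++ ([:: s; s] ++ u).
  by rewrite rev_cons -cats1 -catA.
apply: Cox_trans IHu; apply: Cox_cat; first exact: Cox_refl.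
rewrite -[X in cox_cong m _ X]cat0s; apply: Cox_cat; last exact: Cox_refl.
by have := Cox_rel (cox_m_diag m s).
Qed.

Definition cox_one (S : finType) (m : coxeterMatrix S) := cox_word m [::].
Definition cox_mul (S : finType) (m : coxeterMatrix S) (g h : coxGroup m) :=
  cox_word m (cox_repr g ++ cox_repr h).
Definition cox_inv (S : finType) (m : coxeterMatrix S) (g : coxGroup m) :=
  cox_word m (rev (cox_repr g)).

Lemma cox_mulE (S : finType) (m : coxeterMatrix S) u v :
  cox_mul (cox_word m u) (cox_word m v) = cox_word m (u ++ v).
Proof. by apply/cox_wordP; apply: Cox_cat; exact: cox_repr_word. Qed.

Lemma cox_invE (S : finType) (m : coxeterMatrix S) u :
  cox_inv (cox_word m u) = cox_word m (rev u).
Proof. by apply/cox_wordP; apply: cox_cong_rev; exact: cox_repr_word. Qed.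

Lemma cox_mulgA (S : finType) (m : coxeterMatrix S) : associative (@cox_mul S m).
Proof.
move=> g h k; rewrite -(cox_reprK g) -(cox_reprK h) -(cox_reprK k).
by rewrite !cox_mulE catA.
Qed.

Lemma cox_mul1g (S : finType) (m : coxeterMatrix S) :
  left_id (cox_one m) (@cox_mul S m).
Proof. by move=> g; rewrite -(cox_reprK g) cox_mulE. Qed.

Lemma cox_mulg1 (S : finType) (m : coxeterMatrix S) :
  right_id (cox_one m) (@cox_mul S m).
Proof. by move=> g; rewrite -(cox_reprK g) cox_mulE cats0. Qed.

Lemma cox_mulVg (S : finType) (m : coxeterMatrix S) :
  left_inverse (cox_one m) (@cox_inv S m) (@cox_mul S m).
Proof.
move=> g; rewrite -(cox_reprK g) cox_invE cox_mulE.
by apply/cox_wordP; exact: cox_cong_revl.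
Qed.

Lemma cox_mulgV (S : finType) (m : coxeterMatrix S) :
  right_inverse (cox_one m) (@cox_inv S m) (@cox_mul S m).
Proof.
move=> g; rewrite -(cox_reprK g) cox_invE cox_mulE.
by apply/cox_wordP; rewrite -{1}[cox_repr g]revK; exact: cox_cong_revl.
Qed.

HB.instance Definition _ (S : finType) (m : coxeterMatrix S) :=
  isGroup.Build (coxGroup m) (@cox_mulgA S m) (@cox_mul1g S m) (@cox_mulg1 S m)
    (@cox_mulVg S m) (@cox_mulgV S m).

Definition cox_gen (S : finType) (m : coxeterMatrix S) (s : S) : coxGroup m :=
  cox_word m [:: s].

Record is_cox_action (S : finType) (m : coxeterMatrix S) (X : Type)
    (f : S -> X -> X) (act : coxGroup m -> X -> X) : Prop := IsCoxAction {
  cox_action1 : forall x, act 1%g x = x;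
  cox_actionM : forall g h x, act (g * h)%g x = act g (act h x);
  cox_action_gen : forall s x, act (cox_gen m s) x = f s x }.

(* This is an action only when f satisfies the relations ([cox_actP]). *)
Definition cox_act (S : finType) (m : coxeterMatrix S) (X : Type)
    (f : S -> X -> X) (w : coxGroup m) (x : X) : X :=
  foldr f x (cox_repr w).

Lemma cox_actP (S : finType) (m : coxeterMatrix S) (X : Type)
    (f : S -> X -> X) :
  (forall s t k x, m s t = Some k -> iter k (fun y => f s (f t y)) x = x) ->
  is_cox_action f (cox_act (m := m) f).
Proof.
move=> frel.
have cf u v : cox_cong m u v -> forall x, foldr f x u = foldr f x v.
  elim=> {u v} //.
  - by move=> u v w _ uv _ vw x; rewrite uv.
  - by move=> u u' v v' _ uu _ vv x; rewrite !foldr_cat vv uu.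
  move=> s t k mst x; rewrite -[RHS](frel s t k x mst).
  by elim: k {mst} => //= k ->.
split=> [x|g h x|s x]; rewrite /cox_act.
- by rewrite (cf _ _ (cox_repr_word m [::])).
- by rewrite (cf _ _ (cox_repr_word m _)) foldr_cat.
- by rewrite (cf _ _ (cox_repr_word m _)).
Qed.

(* The basis element b_1 = 1 has index [ord0]; [fr_coord] gives the
   coordinates in the basis, so that _j c_{k,i} = fr_coord (b_j * b_k) i. *)
Record fusionRing := FusionRing {
  fr_ring :> nzRingType;
  fr_n : nat;
  fr_b : 'I_fr_n.+1 -> fr_ring;
  fr_coord : fr_ring -> 'I_fr_n.+1 -> int;
  fr_coordK : forall x, \sum_i fr_b i *~ fr_coord x i = x;
  fr_coord_uniq : forall (c : 'I_fr_n.+1 -> int) i,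
    fr_coord (\sum_k fr_b k *~ c k) i = c i;
  fr_b1 : fr_b ord0 = 1;
  fr_mul_neq0 : forall j k, fr_b j * fr_b k != 0;
  fr_mul_ge0 : forall j k i, 0 <= fr_coord (fr_b j * fr_b k) i;
  fr_dual : 'I_fr_n.+1 -> 'I_fr_n.+1;
  fr_dualK : involutive fr_dual;
  fr_star : fr_ring -> fr_ring := fun x => \sum_i fr_b (fr_dual i) *~ fr_coord x i;
  fr_starM : forall x y, fr_star (x * y) = fr_star y * fr_star x;
  fr_trace : forall j k,
    fr_coord (fr_b j * fr_b k) ord0 = (k == fr_dual j)%:R }.

Arguments fr_b {_} _.
Arguments fr_coord {_} _ _.
Arguments fr_dual {_} _.
Arguments fr_star {_} _.

Notation fr_index F := 'I_(fr_n F).+1.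

Definition fr_nonneg (F : fusionRing) (x : F) : Prop :=
  forall i, 0 <= fr_coord x i.

Definition fr_mx (K : realType) (F : fusionRing) (j : fr_index F) :
    'M[K]_((fr_n F).+1) :=
  \matrix_(k, l) (fr_coord (fr_b j * fr_b k) l)%:~R.

(* The supremum of a finite set, non-empty by the Perron-Frobenius theorem. *)
Definition FPdim_basis (K : realType) (F : fusionRing) (j : fr_index F) : K :=
  sup [set x : K | 0 <= x /\ eigenvalue (fr_mx K j) x].

Definition FPdim (K : realType) (F : fusionRing) (x : F) : K :=
  \sum_i FPdim_basis K i *~ fr_coord x i.

(* F^o is F as a left module over itself. *)
Definition RLambda (F : fusionRing) (S : finType) : lmodType F :=
  {ffun S -> (F : nzRingType)^o}.

Definition simple_root (F : fusionRing) (S : finType) (s : S) : RLambda F S :=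
  [ffun t => (t == s)%:R].

Definition gr_refl (F : fusionRing) (S : finType)
    (B : RLambda F S -> RLambda F S -> F) (s : S) (v : RLambda F S) :
    RLambda F S :=
  v - B (simple_root F s) v *: simple_root F s.

Record geomRealisation (K : realType) (F : fusionRing) (S : finType)
    (m : coxeterMatrix S) := GeomRealisation {
  gr_form : RLambda F S -> RLambda F S -> F;
  gr_r : S -> S -> F :=
    fun s t => gr_form (simple_root F s) (simple_root F t);
  gr_formDl : forall u u' v, gr_form (u + u') v = gr_form u v + gr_form u' v;
  gr_formDr : forall u v v', gr_form u (v + v') = gr_form u v + gr_form u v';
  gr_formE : forall (x y : F) s t,
    gr_form (x *: simple_root F s) (y *: simple_root F t) =
    y * gr_r s t * fr_star x;
  gr_r_diag : forall s, gr_r s s = 2;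
  gr_r_nonneg : forall s t, s != t -> fr_nonneg (- gr_r s t);
  gr_r_star : forall s t, s != t -> gr_r t s = fr_star (gr_r s t);
  gr_r_fin : forall s t k, s != t -> m s t = Some k ->
    FPdim K (gr_r s t) = - (2 * cos (trigo.pi / k%:R));
  gr_r_inf : forall s t, s != t -> m s t = None ->
    FPdim K (gr_r s t) <= - 2;
  gr_act : coxGroup m -> RLambda F S -> RLambda F S;
  gr_act_linear : forall w, linear (gr_act w);
  gr_actP : is_cox_action (gr_refl gr_form) gr_act }.

Notation unfold_index F S := (fr_index F * S)%type.

Definition unfold_r (K : realType) (F : fusionRing) (S : finType)
    (m : coxeterMatrix S) (L : geomRealisation K F m)
    (x y : unfold_index F S) : int :=
  if x == y then 2
  else if x.2 == y.2 then 0
  else fr_coord (fr_b y.1 * gr_r L x.2 y.2) x.1.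

(* Off-diagonal entries are <= 0, so the last branch is the case r <= -2. *)
Definition unfold_m (K : realType) (F : fusionRing) (S : finType)
    (m : coxeterMatrix S) (L : geomRealisation K F m)
    (x y : unfold_index F S) : option nat :=
  if x == y then Some 1%N
  else if unfold_r L x y == 0 then Some 2%N
  else if unfold_r L x y == -1 then Some 3%N
  else None.

Lemma fr_coordD (F : fusionRing) (x y : F) i :
  fr_coord (x + y) i = fr_coord x i + fr_coord y i.
Proof.
rewrite -{1}(fr_coordK x) -{1}(fr_coordK y) -big_split /=.
under eq_bigr do rewrite -mulrzDr.
exact: (fr_coord_uniq (fun k => fr_coord x k + fr_coord y k)).
Qed.

Lemma fr_coord0 (F : fusionRing) i : fr_coord (0 : F) i = 0.
Proof. by apply: (addrI (fr_coord (0 : F) i)); rewrite -fr_coordD !addr0. Qed.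

Lemma fr_coordN (F : fusionRing) (x : F) i : fr_coord (- x) i = - fr_coord x i.
Proof. by apply: (addrI (fr_coord x i)); rewrite -fr_coordD !subrr fr_coord0. Qed.

Lemma fr_coord_mulrz (F : fusionRing) (x : F) (z : int) i :
  fr_coord (x *~ z) i = fr_coord x i * z.
Proof.
have cn n : fr_coord (x *+ n) i = fr_coord x i *+ n.
  by elim: n => [|n IH]; rewrite ?fr_coord0 // !mulrS fr_coordD IH.
case: z => n; rewrite ?NegzE ?mulrNz ?fr_coordN ?mulrN -pmulrn cn -mulr_natr //.
all: by rewrite natz.
Qed.

Lemma fr_coord_sum (F : fusionRing) (I : finType) (G : I -> F) i :
  fr_coord (\sum_k G k) i = \sum_k fr_coord (G k) i.
Proof.
by apply: (big_morph (fun x => fr_coord x i)) => [x y|];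
  rewrite ?fr_coordD ?fr_coord0.
Qed.

Lemma fr_coord_b (F : fusionRing) (j i : fr_index F) :
  fr_coord (fr_b j) i = (i == j)%:R.
Proof.
rewrite -(fr_coord_uniq (fun k => (k == j)%:R)) (bigD1 j) //= eqxx.
by rewrite big1 ?addr0 ?mulr1z // => k /negPf ->; rewrite mulr0z.
Qed.

Lemma fr_tau_mul (F : fusionRing) (x y : F) :
  fr_coord (x * y) ord0 = \sum_i fr_coord x i * fr_coord y (fr_dual i).
Proof.
rewrite -{1}(fr_coordK x) mulr_suml fr_coord_sum; apply: eq_bigr => i _.
rewrite mulrzAl fr_coord_mulrz mulrC; congr (_ * _).
rewrite -{1}(fr_coordK y) mulr_sumr fr_coord_sum (bigD1 (fr_dual i)) //=.
rewrite mulrzAr fr_coord_mulrz fr_trace eqxx mul1r big1 ?addr0 // => k nk.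
by rewrite mulrzAr fr_coord_mulrz fr_trace (negPf nk) mul0r.
Qed.

Lemma fr_tauC (F : fusionRing) (x y : F) :
  fr_coord (x * y) ord0 = fr_coord (y * x) ord0.
Proof.
rewrite !fr_tau_mul (reindex_inj (can_inj (@fr_dualK F))) /=.
by apply: eq_bigr => i _; rewrite fr_dualK mulrC.
Qed.

Lemma fr_coord_star (F : fusionRing) (x : F) i :
  fr_coord (fr_star x) i = fr_coord x (fr_dual i).
Proof.
rewrite /fr_star (reindex_inj (can_inj (@fr_dualK F))) /=.
under eq_bigr do rewrite fr_dualK.
exact: (fr_coord_uniq (fun k => fr_coord x (fr_dual k))).
Qed.

Lemma fr_dual0 (F : fusionRing) : fr_dual (ord0 : fr_index F) = ord0.
Proof.
have := @fr_trace F ord0 ord0; rewrite fr_b1 mul1r -(fr_b1 F) fr_coord_b eqxx.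
by case: eqP.
Qed.

Lemma fr_coordE (F : fusionRing) (x : F) i :
  fr_coord x i = fr_coord (fr_b (fr_dual i) * x) ord0.
Proof.
rewrite fr_tau_mul (bigD1 (fr_dual i)) //= fr_coord_b eqxx mul1r fr_dualK.
by rewrite big1 ?addr0 // => k /negPf nk; rewrite fr_coord_b nk mul0r.
Qed.

Lemma fr_star_b (F : fusionRing) (j : fr_index F) :
  fr_star (fr_b j) = fr_b (fr_dual j).
Proof.
rewrite /fr_star (bigD1 j) //= fr_coord_b eqxx mulr1z big1 ?addr0 // => k nk.
by rewrite fr_coord_b (negPf nk) mulr0z.
Qed.

Lemma unfold_r_sym (K : realType) (F : fusionRing) (S : finType)
    (m : coxeterMatrix S) (L : geomRealisation K F m) x y :
  unfold_r L x y = unfold_r L y x.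
Proof.
rewrite /unfold_r eq_sym; case: eqP => // _.
rewrite eq_sym; case: eqVneq => // nst.
case: x y nst => [i s] [j t] /=; rewrite eq_sym => nst; rewrite (gr_r_star L nst).
rewrite [LHS]fr_coordE [RHS]fr_coordE.
rewrite -[in RHS](@fr_dualK F i) -(fr_star_b (fr_dual i)) -(fr_star_b j).
rewrite -!fr_starM fr_coord_star fr_dual0.
by rewrite -mulrA [in RHS]fr_tauC mulrA.
Qed.

Lemma unfold_m_sym (K : realType) (F : fusionRing) (S : finType)
    (m : coxeterMatrix S) (L : geomRealisation K F m) x y :
  unfold_m L x y = unfold_m L y x.
Proof. by rewrite /unfold_m eq_sym unfold_r_sym. Qed.

Lemma unfold_m_diag (K : realType) (F : fusionRing) (S : finType)
    (m : coxeterMatrix S) (L : geomRealisation K F m) x :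
  unfold_m L x x = Some 1%N.
Proof. by rewrite /unfold_m eqxx. Qed.

Lemma unfold_m_off (K : realType) (F : fusionRing) (S : finType)
    (m : coxeterMatrix S) (L : geomRealisation K F m) x y k :
  x != y -> unfold_m L x y = Some k -> (2 <= k)%N.
Proof.
by rewrite /unfold_m => /negPf ->; case: ifP => _; [|case: ifP => _] => // -[<-].
Qed.

Definition unfold_cox (K : realType) (F : fusionRing) (S : finType)
    (m : coxeterMatrix S) (L : geomRealisation K F m) :
    coxeterMatrix (unfold_index F S) :=
  CoxeterMatrix (unfold_m_sym L) (unfold_m_diag L) (@unfold_m_off _ _ _ _ L).

Definition ZLambda (F : fusionRing) (S : finType) : zmodType :=
  {ffun unfold_index F S -> int}.

Definition zsimple_root (F : fusionRing) (S : finType)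
    (x : unfold_index F S) : ZLambda F S := [ffun y => (y == x)%:R].

Definition zform (K : realType) (F : fusionRing) (S : finType)
    (m : coxeterMatrix S) (L : geomRealisation K F m) (u v : ZLambda F S) :
    int :=
  \sum_x \sum_y u x * unfold_r L x y * v y.

Definition zrefl (K : realType) (F : fusionRing) (S : finType)
    (m : coxeterMatrix S) (L : geomRealisation K F m)
    (x : unfold_index F S) (v : ZLambda F S) : ZLambda F S :=
  v - zsimple_root x *~ zform L (zsimple_root x) v.

Definition unfold_act (K : realType) (F : fusionRing) (S : finType)
    (m : coxeterMatrix S) (L : geomRealisation K F m)
    (w : coxGroup (unfold_cox L)) : ZLambda F S -> ZLambda F S :=
  cox_act (zrefl L) w.

Lemma zform_root (K : realType) (F : fusionRing) (S : finType)
    (m : coxeterMatrix S) (L : geomRealisation K F m) x v :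
  zform L (zsimple_root x) v = \sum_y unfold_r L x y * v y.
Proof.
rewrite /zform (bigD1 x) //= [X in _ + X]big1 ?addr0 => [|z /negPf nz].
  by apply: eq_bigr => y _; rewrite ffunE eqxx mul1r.
by apply: big1 => y _; rewrite ffunE nz !mul0r.
Qed.

Lemma zform_roots (K : realType) (F : fusionRing) (S : finType)
    (m : coxeterMatrix S) (L : geomRealisation K F m) x y :
  zform L (zsimple_root x) (zsimple_root y) = unfold_r L x y.
Proof.
rewrite zform_root (bigD1 y) //= ffunE eqxx mulr1 big1 ?addr0 // => z /negPf nz.
by rewrite ffunE nz mulr0.
Qed.

Lemma zformDr (K : realType) (F : fusionRing) (S : finType)
    (m : coxeterMatrix S) (L : geomRealisation K F m) x u v :
  zform L (zsimple_root x) (u + v) =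
  zform L (zsimple_root x) u + zform L (zsimple_root x) v.
Proof.
rewrite !zform_root -big_split /=.
by apply: eq_bigr => y _; rewrite ffunE mulrDr.
Qed.

Lemma ZLambda_mulrzE (F : fusionRing) (S : finType) (v : ZLambda F S) (z : int) x :
  (v *~ z) x = v x * z.
Proof.
case: z => n; first by rewrite -pmulrn ffunMnE -mulr_natr natz.
by rewrite NegzE mulrNz ffunE -pmulrn ffunMnE -mulr_natr natz mulrN.
Qed.

Lemma zform_mulrz (K : realType) (F : fusionRing) (S : finType)
    (m : coxeterMatrix S) (L : geomRealisation K F m) x v (z : int) :
  zform L (zsimple_root x) (v *~ z) = zform L (zsimple_root x) v * z.
Proof.
rewrite !zform_root mulr_suml.
by apply: eq_bigr => y _; rewrite ZLambda_mulrzE mulrA.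
Qed.

Lemma unfold_actP (K : realType) (F : fusionRing) (S : finType)
    (m : coxeterMatrix S) (L : geomRealisation K F m) :
  is_cox_action (zrefl L) (@unfold_act K F S m L).
Proof.
apply: cox_actP => x y k v.
pose a := zsimple_root x; pose b := zsimple_root y; pose r := unfold_r L x y.
pose p := zform L a v; pose q := zform L b v.
have fa i j :
    zrefl L x (v + a *~ i + b *~ j) = v + a *~ (- p - i - r * j) + b *~ j.
  rewrite /zrefl !zformDr !zform_mulrz !zform_roots -/a -/r -/p.
  rewrite {1}/unfold_r eqxx addrAC; congr (_ + _); rewrite -addrA; congr (_ + _).
  by rewrite -mulrzBr; congr (_ *~ _); ring.
have fb i j :
    zrefl L y (v + a *~ i + b *~ j) = v + a *~ i + b *~ (- q - j - r * i).
  rewrite /zrefl !zformDr !zform_mulrz !zform_roots -/b -/q.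
  rewrite (unfold_r_sym L y x) -/r.
  rewrite {1}/unfold_r eqxx -addrA; congr (_ + _).
  by rewrite -mulrzBr; congr (_ *~ _); ring.
have v0 : v = v + a *~ 0 + b *~ 0 by rewrite !mulr0z !addr0.
rewrite /= /unfold_m; case: eqP => [exy|_].
  case=> <- /=; rewrite -exy v0 !fa mulr0z; congr (_ + _ *~ _ + _).
  by ring.
case: eqP => [r0|_]; [move=> [<-]|case: eqP => [r1|//] [<-]] => /=.
  rewrite {1}v0 !(fa, fb) /r r0 [RHS]v0.
  by congr (_ + _ *~ _ + _ *~ _); ring.
rewrite {1}v0 !(fa, fb) /r r1 [RHS]v0.
by congr (_ + _ *~ _ + _ *~ _); ring.
Qed.

(* The identification alpha_{b,s} <-> b alpha_s. *)
Definition ZtoR (F : fusionRing) (S : finType) (v : ZLambda F S) :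
    RLambda F S :=
  \sum_x (fr_b x.1 *: simple_root F x.2) *~ v x.

Definition RtoZ (F : fusionRing) (S : finType) (v : RLambda F S) :
    ZLambda F S :=
  [ffun x => fr_coord (v x.2) x.1].

Lemma ZtoRE (F : fusionRing) (S : finType) (v : ZLambda F S) s :
  ZtoR v s = \sum_i fr_b i *~ v (i, s).
Proof.
have mulrzE (u : RLambda F S) (z : int) : (u *~ z) s = u s *~ z.
  case: z => n; first by rewrite -!pmulrn ffunMnE.
  by rewrite NegzE !mulrNz ffunE -!pmulrn ffunMnE.
have sumE (J : finType) (G : J -> RLambda F S) :
    (\sum_k G k) s = \sum_k G k s.
  by rewrite sum_ffunE.
rewrite /ZtoR sumE; under eq_bigr do rewrite mulrzE.
rewrite (eq_bigr (fun p => (fr_b p.1 *: simple_root F p.2 : RLambda F S) s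
                           *~ v (p.1, p.2))); last by case.
rewrite -(pair_bigA _ (fun i t =>
  (fr_b i *: simple_root F t : RLambda F S) s *~ v (i, t))) /=.
apply: eq_bigr => i _; rewrite (bigD1 s) //= big1 ?addr0 => [|t /negPf nt].
  by rewrite !ffunE eqxx [_ *: _]mulr1.
by rewrite !ffunE eq_sym nt [_ *: _]mulr0 mul0rz.
Qed.

Lemma RtoZK (F : fusionRing) (S : finType) :
  cancel (@RtoZ F S) (@ZtoR F S).
Proof.
move=> v; apply/ffunP => s; rewrite ZtoRE -[RHS](fr_coordK (v s)).
by apply: eq_bigr => i _; rewrite ffunE.
Qed.

Lemma ZtoRK (F : fusionRing) (S : finType) :
  cancel (@ZtoR F S) (@RtoZ F S).
Proof.
move=> v; apply/ffunP => -[i s]; rewrite ffunE /= ZtoRE.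
exact: (fr_coord_uniq (fun k => v (k, s))).
Qed.

Definition unfold_actR (K : realType) (F : fusionRing) (S : finType)
    (m : coxeterMatrix S) (L : geomRealisation K F m)
    (w : coxGroup (unfold_cox L)) (v : RLambda F S) : RLambda F S :=
  ZtoR (unfold_act w (RtoZ v)).

Lemma unfold_actRP (K : realType) (F : fusionRing) (S : finType)
    (m : coxeterMatrix S) (L : geomRealisation K F m) :
  is_cox_action (fun x v => ZtoR (zrefl L x (RtoZ v))) (@unfold_actR K F S m L).
Proof.
have [a1 aM ag] := unfold_actP L; split=> [v|g h v|x v]; rewrite /unfold_actR.
- by rewrite a1 RtoZK.
- by rewrite aM ZtoRK.
- by rewrite ag.
Qed.

Definition HomZ (K : realType) (F : fusionRing) (S : finType) :
    set (RLambda F S -> K) :=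
  [set Z | forall u v, Z (u + v) = Z u + Z v].

Definition HomR (K : realType) (F : fusionRing) (S : finType) :
    set (RLambda F S -> K) :=
  [set Z | HomZ Z /\ forall (r : F) v, Z (r *: v) = FPdim K r * Z v].

Definition dual_act (G : groupType) (V T : Type) (act : G -> V -> V) (w : G)
    (Z : V -> T) : V -> T :=
  fun v => Z (act w^-1%g v).

Definition fixed_in (G : groupType) (V T : Type) (act : G -> V -> V)
    (H : set (V -> T)) (w : G) : set (V -> T) :=
  [set Z | H Z /\ dual_act act w Z = Z].

Definition hyperplanes (S : finType) (m : coxeterMatrix S) (V T : Type)
    (act : coxGroup m -> V -> V) (H : set (V -> T)) : set (set (V -> T)) :=
  [set fixed_in act H (p.1 * cox_gen m p.2 * p.1^-1)%g
     | p in [set: coxGroup m * S]].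

Definition hyperplanesR (K : realType) (F : fusionRing) (S : finType)
    (m : coxeterMatrix S) (L : geomRealisation K F m) :=
  hyperplanes (gr_act L) (@HomR K F S).

Definition hyperplanesZ (K : realType) (F : fusionRing) (S : finType)
    (m : coxeterMatrix S) (L : geomRealisation K F m) :=
  hyperplanes (@unfold_actR K F S m L) (@HomZ K F S).

(* Main.v *)
(* Nonzero elements of HomR force FPdim to be multiplicative, since
   FPdim (a b) Z(v) = Z(a b v) = FPdim (a) FPdim (b) Z(v); when HomR = 0 every
   hyperplane restricts to {0}.  The hyperplane of w s w^-1 is
   {Z | Z(w alpha_s) = 0}, and likewise for the unfolded group.

   A simple reflection s of W acts as the product of the commuting reflections
   (b, s), so every w alpha_s is an unfolded root; this gives one inclusion.

   Conversely, an unfolded root has norm 2 for the even form B_Z.  Averaging over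
   the finite group W gives a positive definite invariant form on the real
   realisation, hence a positive vector y with sum_s y_s FPdim (r_{s,t}) constant
   and positive.  The vector FPdim (b) y_s then makes B_Z positive definite, and
   a norm 2 vector of an even positive definite lattice with off-diagonal entries
   <= 0 is nonnegative or nonpositive.  As the W-average of the height vanishes,
   some w makes a nonnegative norm 2 vector v nonpositive; just before the sign
   changes along a word of w the vector is some b alpha_s, so v = b w' alpha_s,
   which defines on HomR the same hyperplane as w' alpha_s. *)
Require Import Defs.
From mathcomp Require Import all_boot all_order all_algebra.
From mathcomp Require Import all_classical all_reals all_analysis.
From mathcomp Require Import ring lra zify.
Local Open Scope classical_set_scope.

Set Implicit Arguments.
Unset Strict Implicit.
Unset Printing Implicit Defensive.

Import Order.TTheory GRing.Theory Num.Theory.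
Local Open Scope ring_scope.

(** * Symmetric matrices with non-positive off-diagonal entries *)

(** Let [y] be the negative part of [x]. Then [x + y] is the positive part, so each term
    [(x i + y i) * y j * A i j] is at most 0 and vanishes for [i = j]. Summing, the form at [y] is
    at most [- c] times the sum of [y], which forces [y = 0]. A zero entry [x i] would make column
    [i] sum to at most 0, against [0 < c]. *)
Lemma mmatrix_pos (K : realFieldType) (I : finType) (A : I -> I -> K)
    (x : I -> K) (c : K) :
  (forall i j, i != j -> A i j <= 0) ->
  (forall y : I -> K, \sum_i y i ^+ 2 <= \sum_i \sum_j y i * y j * A i j) ->
  0 < c -> (forall j, \sum_i x i * A i j = c) ->
  forall i, 0 < x i.
Proof.
move=> Aoff Apos c0 xA.
pose y i := Num.max 0 (- x i).
have y0 i : 0 <= y i by rewrite le_max lexx.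
have sumy : \sum_i y i ^+ 2 <= 0.
  apply: le_trans (Apos y) _.
  have : 0 <= \sum_j y j * c by apply: sumr_ge0 => j _; rewrite mulr_ge0 // ltW.
  rewrite -oppr_le0; apply: le_trans; rewrite -sumrN exchange_big /=.
  apply: ler_sum => j _; rewrite -(xA j) mulr_sumr -sumrN.
  apply: ler_sum => i _; rewrite -subr_ge0.
  have -> : - (y j * (x i * A i j)) - y i * y j * A i j =
            - ((x i + y i) * y j * A i j) by ring.
  rewrite oppr_ge0; have [->|ij] := eqVneq i j.
    rewrite (_ : (x j + y j) * y j = 0) ?mul0r //.
    by rewrite /y; case: (leP 0 (- x j)) => _; ring.
  rewrite mulr_ge0_le0 ?Aoff ?mulr_ge0 //.
  by rewrite /y; case: (leP 0 (- x i)) => h; lra.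
have x0 i : 0 <= x i.
  have : y i ^+ 2 <= 0.
    apply: le_trans sumy; rewrite (bigD1 i) //= lerDl.
    by apply: sumr_ge0 => j _; rewrite sqr_ge0.
  move=> yi.
  have : y i == 0 by rewrite -sqrf_eq0 eq_le yi sqr_ge0.
  by rewrite /y; case: (leP 0 (- x i)) => h // /eqP; lra.
move=> i; rewrite lt_neqAle x0 andbT; apply/negP => /eqP xi.
have := xA i; rewrite (bigD1 i) //= -xi mul0r add0r => E.
suff : c <= 0 by rewrite leNgt c0.
by rewrite -E; apply: sumr_le0 => j ij; rewrite mulr_ge0_le0 ?Aoff.
Qed.

(** Writing [v i = x i * u i] turns the form into the sum of [x i * u i ^+ 2 * (A x) i] minus half
    the sum of [A i j * x i * x j * (u i - u j) ^+ 2]. The first sum is positive, and the second is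
    at most 0. *)
Lemma symmetric_posdef (K : realFieldType) (I : finType) (A : I -> I -> K)
    (x v : I -> K) :
  (forall i j, A i j = A j i) -> (forall i j, i != j -> A i j <= 0) ->
  (forall i, 0 < x i) -> (forall i, 0 < \sum_j A i j * x j) ->
  (exists i, v i != 0) ->
  0 < \sum_i \sum_j v i * A i j * v j.
Proof.
move=> Asym Aoff x0 Ax0 [k vk].
pose u i := v i / x i.
have vE i : v i = x i * u i by rewrite /u mulrC divfK // gt_eqF.
pose D := \sum_i x i * u i ^+ 2 * \sum_j A i j * x j.
pose E := \sum_i \sum_j A i j * x i * x j * (u i - u j) ^+ 2.
have -> : \sum_i \sum_j v i * A i j * v j = D - E / 2.
  have DE : D = \sum_i \sum_j x i * u i ^+ 2 * (A i j * x j).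
    by apply: eq_bigr => i _; rewrite mulr_sumr.
  have DE' : D = \sum_i \sum_j x j * u j ^+ 2 * (A i j * x i).
    rewrite DE exchange_big; apply: eq_bigr => i _; apply: eq_bigr => j _.
    by rewrite Asym.
  apply: (@mulfI _ 2); first by rewrite pnatr_eq0.
  rewrite mulrBr [2 * (E / 2)]mulrC divfK ?pnatr_eq0 //.
  rewrite [2 * D](_ : _ = D + D); last by ring.
  rewrite {1}DE DE' /E -big_split -sumrB mulr_sumr /=.
  apply: eq_bigr => i _; rewrite -big_split -sumrB mulr_sumr /=.
  by apply: eq_bigr => j _; rewrite !vE; ring.
have E0 : E <= 0.
  apply: sumr_le0 => i _; apply: sumr_le0 => j _.
  have [->|ij] := eqVneq i j; first by rewrite subrr expr0n mulr0.
  have := Aoff _ _ ij; have := x0 i; have := x0 j => xj xi Aij.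
  by rewrite mulr_le0_ge0 ?sqr_ge0 ?mulr_le0_ge0 // ltW.
suff : 0 < D by lra.
rewrite /D (bigD1 k) //= ltr_wpDr //.
  apply: sumr_ge0 => i _.
  exact: mulr_ge0 (mulr_ge0 (ltW (x0 i)) (sqr_ge0 _)) (ltW (Ax0 i)).
apply: mulr_gt0 => //; apply: mulr_gt0 => //; rewrite exprn_even_gt0 //=.
by rewrite /u mulf_neq0 // invr_neq0 // gt_eqF.
Qed.

Lemma even_form (I : finType) (A : I -> I -> int) (v : I -> int) :
  (forall i j, A i j = A j i) -> (forall i, A i i = 2) ->
  exists z, \sum_i \sum_j v i * A i j * v j = 2 * z.
Proof.
move=> Asym Adiag; pose f i j := v i * A i j * v j.
(* An auxiliary total order picks one term from each pair of equal off-diagonal terms. *)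
pose lt (i j : I) := (enum_rank i < enum_rank j)%N.
exists (\sum_i (v i ^+ 2 + \sum_(j | lt i j) f i j)).
rewrite mulr_sumr.
under [RHS]eq_bigr => i _ do rewrite mulrDr -{1}(Adiag i).
rewrite big_split /=.
have -> : \sum_i 2 * (\sum_(j | lt i j) f i j) =
    \sum_i (\sum_(j | lt i j) f i j) + \sum_i (\sum_(j | lt j i) f i j).
  rewrite [X in _ + X](_ : _ = \sum_i (\sum_(j | lt i j) f i j)).
    by rewrite -big_split; apply: eq_bigr => i _ /=; lia.
  rewrite (exchange_big_dep xpredT) //=.
  apply: eq_bigr => i _; apply: eq_bigr => j _.
  by rewrite /f Asym; ring.
rewrite -!big_split; apply: eq_bigr => i _ /=.
rewrite (bigD1 i) //=; congr (_ + _); first by rewrite Adiag; ring.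
rewrite (bigID (lt i)) /=; congr (_ + _); apply: eq_bigl => j.
  by rewrite /lt; case: eqVneq => [->|] //=; rewrite ltnn.
rewrite /lt -leqNgt; case: eqVneq => [->|ij] /=; first by rewrite ltnn.
by rewrite [in RHS]ltn_neqAle (inj_eq val_inj) (inj_eq enum_rank_inj) ij.
Qed.

(** Split [v] into positive part [p] and negative part [n]. The cross terms of [v = p - n] only add
    to the norm, so [q p + q n <= 2]. By evenness and positivity each nonzero part contributes at
    least 2, hence one of them vanishes. *)
Lemma norm2_sign (I : finType) (A : I -> I -> int) (v : I -> int) :
  (forall i j, A i j = A j i) -> (forall i, A i i = 2) ->
  (forall i j, i != j -> A i j <= 0) ->
  (forall u, (exists i, u i != 0) -> 0 < \sum_i \sum_j u i * A i j * u j) ->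
  \sum_i \sum_j v i * A i j * v j = 2 ->
  (forall i, 0 <= v i) \/ (forall i, v i <= 0).
Proof.
move=> Asym Adiag Aoff Apos qv.
pose p i := Num.max 0 (v i); pose n i := Num.max 0 (- v i).
pose q u := \sum_i \sum_j u i * A i j * u j.
have ge2 u i : u i != 0 -> 2 <= q u.
  move=> ui; have := Apos u (ex_intro _ i ui); rewrite -/(q u).
  by have [z qz] : exists z, q u = 2 * z := even_form u Asym Adiag; lia.
have le : q p + q n <= 2.
  rewrite -qv -big_split; apply: ler_sum => i _; rewrite -big_split.
  apply: ler_sum => j _ /=; have [<-|ij] := eqVneq i j.
    by rewrite /p /n Adiag; case: (leP 0 (v i)); case: (leP 0 (- v i)); nia.
  have := Aoff _ _ ij; rewrite /p /n.
  by case: (leP 0 (v i)); case: (leP 0 (- v i));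
    case: (leP 0 (v j)); case: (leP 0 (- v j)); nia.
have [h|/existsNP[i /negP vi]] := pselect (forall i, 0 <= v i); first by left.
have n2 : 2 <= q n by apply: (ge2 _ i); rewrite /n; case: (leP 0 (- v i)); lia.
right=> j; rewrite leNgt; apply/negP => vj.
have : 2 <= q p by apply: (ge2 _ j); rewrite /p; case: (leP 0 (v j)); lia.
by lia.
Qed.

(** * Actions of Coxeter groups and fixed functions of conjugated generators *)

Section CoxAction.
Variables (S : finType) (m : coxeterMatrix S) (X : Type) (f : S -> X -> X).
Variable act : coxGroup m -> X -> X.
Hypothesis actP : is_cox_action f act.

Lemma cox_act_word u x : act (cox_word m u) x = foldr f x u.
Proof.
have [a1 aM ag] := actP; elim: u => [|s u IHu] /=; first exact: a1.
by rewrite -IHu -ag -aM; congr act; rewrite [RHS]cox_mulE.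
Qed.

Lemma cox_actK w : cancel (act w) (act w^-1%g).
Proof. by move=> x; rewrite -(cox_actionM actP) mulVg (cox_action1 actP). Qed.

Lemma cox_actVK w : cancel (act w^-1%g) (act w).
Proof. by move=> x; rewrite -(cox_actionM actP) mulgV (cox_action1 actP). Qed.

(** Substituting [act w x] for the argument moves the conjugation into [Z]. The set [H] is
    arbitrary, so that both the group and its unfolding are covered. *)
Lemma fixed_in_conj (T : Type) (H : set (X -> T)) w s Z :
  fixed_in act H (w * cox_gen m s * w^-1)%g Z <->
  H Z /\ forall x, Z (act w (f s x)) = Z (act w x).
Proof.
have [a1 aM ag] := actP; pose g := (w * cox_gen m s * w^-1)%g.
have gE x : act g (act w x) = act w (f s x).
  by rewrite /g 2!aM cox_actK ag.
split=> -[HZ ZE]; split=> //.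
  move=> x; have := congr1 (fun h => h (act g (act w x))) ZE.
  by rewrite /dual_act cox_actK gE.
apply/funext => x; rewrite /dual_act -/g.
by rewrite -[in RHS](cox_actVK g x) -(cox_actVK w (act g^-1%g x)) gE ZE.
Qed.

End CoxAction.

(** * The integral form and the unfolded reflections on the module over the fusion ring *)

Section Lattice.
Variables (K : realType) (F : fusionRing) (S : finType) (m : coxeterMatrix S).
Variable L : geomRealisation K F m.
Implicit Types (x y : unfold_index F S) (u v : RLambda F S).

(** Since [r_{s,s} = 2], the product formula also gives the entries with equal second components. *)
Lemma unfold_rE x y : unfold_r L x y = fr_coord (fr_b y.1 * gr_r L x.2 y.2) x.1.
Proof.
rewrite /unfold_r; case: x y => [i s] [j t] /=; rewrite xpair_eqE.
case: (eqVneq s t) => [->|_]; rewrite ?andbT ?andbF //.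
rewrite gr_r_diag mulr_natr [RHS](_ : _ = fr_coord (fr_b j *~ 2) i) //.
rewrite fr_coord_mulrz fr_coord_b.
by case: eqVneq => _; rewrite ?mul1r ?mul0r.
Qed.

Lemma unfold_r_off x y : x != y -> unfold_r L x y <= 0.
Proof.
move=> xy; rewrite /unfold_r (negPf xy); case: eqVneq => // st.
rewrite -oppr_ge0 -fr_coordN -mulrN -[- _]fr_coordK mulr_sumr fr_coord_sum.
apply: sumr_ge0 => k _; rewrite mulrzAr fr_coord_mulrz.
by rewrite mulr_ge0 ?fr_mul_ge0 // (gr_r_nonneg L st).
Qed.

Lemma unfold_r_diag x : unfold_r L x x = 2.
Proof. by rewrite /unfold_r eqxx. Qed.

Definition zroot x : RLambda F S := fr_b x.1 *: simple_root F x.2.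

Lemma RLambda_sum v : v = \sum_s v s *: simple_root F s.
Proof.
apply/ffunP => t; rewrite sum_ffunE (bigD1 t) //= !ffunE eqxx [_ *: _]mulr1.
rewrite big1 ?addr0 // => s /negPf st.
by rewrite !ffunE eq_sym st [_ *: _]mulr0.
Qed.

Lemma gr_form_root s v : gr_form L (simple_root F s) v = \sum_t v t * gr_r L s t.
Proof.
have f0 : gr_form L (simple_root F s) 0 = 0.
  by apply: (addrI (gr_form L (simple_root F s) 0)); rewrite -gr_formDr !addr0.
rewrite {1}[v]RLambda_sum (big_morph _ (gr_formDr _ _) f0).
apply: eq_bigr => t _; rewrite -[simple_root F s]scale1r gr_formE.
by rewrite -(fr_b1 F) fr_star_b fr_dual0 fr_b1 mulr1.
Qed.

(** The link between the two actions: the reflection in [(b, s)] subtracts exactly the [b]-part of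
    the multiple of the simple root that [s] subtracts. *)
Lemma zform_gr_form x v :
  zform L (zsimple_root x) (RtoZ v) =
  fr_coord (gr_form L (simple_root F x.2) v) x.1.
Proof.
rewrite zform_root gr_form_root fr_coord_sum.
rewrite [RHS](eq_bigr (fun t => \sum_j unfold_r L x (j, t) * RtoZ v (j, t))).
  rewrite exchange_big pair_bigA; apply: eq_bigr => -[j t] _ //.
move=> t _; rewrite -{1}[v t]fr_coordK mulr_suml fr_coord_sum.
apply: eq_bigr => j _; rewrite unfold_rE ffunE /=.
by rewrite mulrzAl fr_coord_mulrz.
Qed.

Lemma ZtoRD (a b : ZLambda F S) : ZtoR (a + b) = ZtoR a + ZtoR b.
Proof.
by rewrite -big_split; apply: eq_bigr => x _; rewrite ffunE mulrzDr.
Qed.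

Lemma RtoZD u v : RtoZ (u + v) = RtoZ u + RtoZ v.
Proof. by apply/ffunP => x; rewrite !ffunE fr_coordD. Qed.

Lemma RtoZN v : RtoZ (- v) = - RtoZ v.
Proof. by apply/ffunP => x; rewrite !ffunE fr_coordN. Qed.

Lemma RtoZ_zroot x : RtoZ (zroot x) = zsimple_root x.
Proof.
apply/ffunP => -[j t]; case: x => i s; rewrite !ffunE /= xpair_eqE.
case: (eqVneq t s) => _; rewrite ?andbT ?andbF.
  by rewrite [_ *: _]mulr1 fr_coord_b.
by rewrite [_ *: _]mulr0 fr_coord0.
Qed.

Lemma ZtoR_mulrz (a : ZLambda F S) z : ZtoR (a *~ z) = ZtoR a *~ z.
Proof.
rewrite /ZtoR mulrz_suml; apply: eq_bigr => x _.
by rewrite ZLambda_mulrzE mulrzA.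
Qed.

Lemma ZtoR_zroot x : ZtoR (zsimple_root x) = zroot x.
Proof. by rewrite -RtoZ_zroot RtoZK. Qed.

Lemma zreflE x v :
  ZtoR (zrefl L x (RtoZ v)) =
  v - zroot x *~ fr_coord (gr_form L (simple_root F x.2) v) x.1.
Proof.
rewrite /zrefl ZtoRD -mulrNz ZtoR_mulrz mulrNz ZtoR_zroot RtoZK.
by rewrite zform_gr_form.
Qed.

Lemma zformC (a b : ZLambda F S) : zform L a b = zform L b a.
Proof.
rewrite /zform exchange_big; apply: eq_bigr => x _; apply: eq_bigr => y _.
by rewrite unfold_r_sym; ring.
Qed.

Lemma zform_zrefl x (a : ZLambda F S) :
  zform L (zrefl L x a) (zrefl L x a) = zform L a a.
Proof.
have zD (u v w : ZLambda F S) : zform L (u + v) w = zform L u w + zform L v w.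
  rewrite /zform -big_split; apply: eq_bigr => i _ /=; rewrite -big_split.
  by apply: eq_bigr => j _; rewrite ffunE /=; ring.
have zM (u w : ZLambda F S) k : zform L (u *~ k) w = zform L u w * k.
  rewrite /zform mulr_suml; apply: eq_bigr => i _; rewrite mulr_suml.
  by apply: eq_bigr => j _; rewrite ZLambda_mulrzE; ring.
rewrite /zrefl -mulrNz; set e := zsimple_root x; set k := zform L e a.
rewrite zD zM [zform L a _]zformC zD zM -/k zformDr zform_mulrz zform_roots.
by rewrite -/k unfold_r_diag; ring.
Qed.

Definition znorm v : int := zform L (RtoZ v) (RtoZ v).

Lemma znorm_unfold_actR (w : coxGroup (unfold_cox L)) v :
  znorm (unfold_actR w v) = znorm v.
Proof.
rewrite /znorm /unfold_actR ZtoRK /unfold_act /cox_act.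
by elim: (cox_repr w) => //= x l IHl; rewrite zform_zrefl.
Qed.

Lemma znorm_zroot x : znorm (zroot x) = 2.
Proof. by rewrite /znorm RtoZ_zroot zform_roots unfold_r_diag. Qed.

Lemma unfold_actRD (w : coxGroup (unfold_cox L)) :
  {morph unfold_actR w : u v / u + v}.
Proof.
move=> u v; rewrite /unfold_actR RtoZD -ZtoRD; congr ZtoR.
rewrite /unfold_act /cox_act; elim: (cox_repr w) => //= x l ->.
by rewrite /zrefl zformDr mulrzDr opprD addrACA.
Qed.

(* The commuting reflections in [(b, s)], for [b] in the basis, compose to [s]. *)
Lemma gr_refl_unfold s : exists w, forall v,
  unfold_actR (L := L) w v = gr_refl (gr_form L) s v.
Proof.
pose f x v := ZtoR (zrefl L x (RtoZ v)).
pose c v i := fr_coord (gr_form L (simple_root F s) v) i.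
have cD u v i : c (u + v) i = c u i + c v i by rewrite /c gr_formDr fr_coordD.
have foldE (l : seq (fr_index F)) v : uniq l ->
    foldr f v [seq (i, s) | i <- l] = v - \sum_(i <- l) zroot (i, s) *~ c v i.
  elim: l => [|i l IHl] /=; first by rewrite big_nil subr0.
  case/andP=> il ul; rewrite IHl // /f zreflE big_cons opprD [- _ - _]addrC addrA.
  congr (_ - _ *~ _); rewrite /= -/(c _ i) cD -[RHS]addr0; congr (_ + _).
  (* The roots subtracted for the letters of [l] are orthogonal to [(i, s)], because [i] is not in
     [l]; so the coefficient at [i] is still that of [v]. *)
  rewrite big_seq; elim/big_rec: _ => [|j v' jl IHv'].
    by rewrite oppr0 /c -[RHS](@fr_coord0 F i) gr_form_root; congr fr_coord;
      rewrite big1 // => t _; rewrite ffunE mul0r.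
  rewrite opprD cD IHv' addr0 -mulrNz -ZtoR_zroot -ZtoR_mulrz.
  rewrite /c -(zform_gr_form (i, s)) ZtoRK zform_mulrz zform_roots.
  rewrite /unfold_r xpair_eqE eqxx andbT; case: eqP => [ij|_] /=; last exact: mul0r.
  by rewrite ij jl in il.
have wE (l : seq (unfold_index F S)) v :
    unfold_actR (cox_word (unfold_cox L) l) v = foldr f v l.
  exact: (cox_act_word (unfold_actRP L)).
exists (cox_word _ [seq (i, s) | i <- enum 'I_(fr_n F).+1]) => v.
rewrite wE foldE ?enum_uniq // big_enum /= /gr_refl; congr (_ - _).
rewrite -[gr_form _ _ _ in RHS]fr_coordK scaler_suml.
by apply: eq_bigr => i _; rewrite /zroot /= -scalerMzl.
Qed.

End Lattice.

(** * Frobenius-Perron dimension *)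

Section FPdimTheory.
Variables (K : realType) (F : fusionRing).
Implicit Types (a b : F) (i j : fr_index F).

Lemma FPdimD : {morph @FPdim K F : a b / a + b}.
Proof.
move=> a b; rewrite -big_split; apply: eq_bigr => i _.
by rewrite fr_coordD mulrzDr.
Qed.

Lemma FPdim0 : FPdim K (0 : F) = 0.
Proof. by apply: (addrI (FPdim K (0 : F))); rewrite -FPdimD !addr0. Qed.

Lemma FPdimN a : FPdim K (- a) = - FPdim K a.
Proof. by apply: (addrI (FPdim K a)); rewrite -FPdimD !subrr FPdim0. Qed.

Lemma FPdim_b i : FPdim K (fr_b i) = FPdim_basis K i.
Proof.
rewrite /FPdim (bigD1 i) //= fr_coord_b eqxx mulr1z big1 ?addr0 // => j /negPf ji.
by rewrite fr_coord_b ji mulr0z.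
Qed.

Lemma FPdim_basis_ge0 i : 0 <= FPdim_basis K i.
Proof.
rewrite /FPdim_basis; set A := [set _ | _].
(* Without a supremum, [sup] takes the default value 0. *)
have [[[x Ax] ubA]|/sup_out ->] := pselect (has_sup A); last by [].
by have [x0 _] := Ax; apply: le_trans x0 _; apply: ub_le_sup.
Qed.

Lemma FPdim_ge0 a : fr_nonneg a -> 0 <= FPdim K a.
Proof.
move=> a0; apply: sumr_ge0 => i _.
by rewrite -mulrzr mulr_ge0 ?FPdim_basis_ge0 // ler0z.
Qed.

(** Kept as a hypothesis below; [HomR_FPdim_monoid] supplies it as soon as some functional in [HomR]
    is nonzero. *)
Definition FPdim_monoid := [/\ FPdim K (1 : F) = 1
  & forall a b, FPdim K (a * b) = FPdim K a * FPdim K b].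

Lemma HomR_FPdim_monoid (S : finType) (Z : RLambda F S -> K) v :
  HomR Z -> Z v != 0 -> FPdim_monoid.
Proof.
move=> [_ ZM] Zv; split=> [|a b]; apply: (mulIf Zv).
  by rewrite -ZM scale1r mul1r.
by rewrite -mulrA -!ZM scalerA.
Qed.

(** The product of [b] and its dual contains 1 with coefficient 1 and has no negative coefficient,
    so its dimension is at least 1 and [FPdim b] cannot vanish. *)
Lemma FPdim_b_gt0 i : FPdim_monoid -> 0 < FPdim K (fr_b i).
Proof.
move=> [d1 dM]; rewrite lt_neqAle FPdim_b FPdim_basis_ge0 andbT eq_sym.
apply/negP => /eqP di; have := dM (fr_b i) (fr_b (fr_dual i)).
rewrite FPdim_b di mul0r => E.
suff : 1 <= FPdim K (fr_b i * fr_b (fr_dual i)) by rewrite E ler10.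
rewrite {1}/FPdim (bigD1 ord0) //= fr_trace eqxx -FPdim_b fr_b1 d1 mulr1z lerDl.
apply: sumr_ge0 => k _.
by rewrite -mulrzr mulr_ge0 ?FPdim_basis_ge0 ?ler0z ?fr_mul_ge0.
Qed.

End FPdimTheory.

(** * Functionals linear over the fusion ring *)

Section HomR.
Variables (K : realType) (F : fusionRing) (S : finType) (m : coxeterMatrix S).
Variable L : geomRealisation K F m.
Implicit Types (u v : RLambda F S) (Z : RLambda F S -> K) (s t : S).

Lemma HomZ0 Z : HomZ Z -> Z 0 = 0.
Proof. by move=> ZD; apply: (addrI (Z 0)); rewrite -ZD !addr0. Qed.

Lemma HomZN Z v : HomZ Z -> Z (- v) = - Z v.
Proof. by move=> ZD; apply: (addrI (Z v)); rewrite -ZD !subrr HomZ0. Qed.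

Lemma HomRE Z v : HomR Z -> Z v = \sum_s FPdim K (v s) * Z (simple_root F s).
Proof.
move=> [ZD ZM]; rewrite {1}[v]RLambda_sum (big_morph _ ZD (HomZ0 ZD)).
by apply: eq_bigr => s _; rewrite ZM.
Qed.

Lemma HomR_sum (I : Type) (r : seq I) (G : I -> RLambda F S -> K) :
  (forall i, HomR (G i)) -> HomR (fun v => \sum_(i <- r) G i v).
Proof.
move=> HG; split=> [u v|a v].
  by rewrite -big_split; apply: eq_bigr => i _; apply: (HG i).1.
by rewrite mulr_sumr; apply: eq_bigr => i _; apply: (HG i).2.
Qed.

Lemma gr_actD w u v : gr_act L w (u + v) = gr_act L w u + gr_act L w v.
Proof. by have := gr_act_linear L w 1 u v; rewrite !scale1r. Qed.

Lemma gr_act0 w : gr_act L w 0 = 0.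
Proof. by apply: (addrI (gr_act L w 0)); rewrite -gr_actD !addr0. Qed.

Lemma gr_actN w v : gr_act L w (- v) = - gr_act L w v.
Proof. by apply: (addrI (gr_act L w v)); rewrite -gr_actD !subrr gr_act0. Qed.

Lemma gr_actZ w a v : gr_act L w (a *: v) = a *: gr_act L w v.
Proof. by have := gr_act_linear L w a v 0; rewrite gr_act0 !addr0. Qed.

Lemma HomR_act w Z : HomR Z -> HomR (fun v => Z (gr_act L w v)).
Proof.
by move=> [ZD ZM]; split=> [u v|a v]; rewrite ?gr_actD ?gr_actZ ?ZD ?ZM. Qed.

Lemma gr_refl_root s :
  gr_refl (gr_form L) s (simple_root F s) = - simple_root F s.
Proof.
rewrite /gr_refl; have -> : gr_form L (simple_root F s) (simple_root F s) = 2.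
  exact: gr_r_diag.
by rewrite scaler_nat mulr2n opprD addNKr.
Qed.

Lemma gr_act_gen s v : gr_act L (cox_gen m s) v = gr_refl (gr_form L) s v.
Proof. exact: (cox_action_gen (gr_actP L)). Qed.

Lemma HomR_refl Z s v : HomR Z -> Z (gr_refl (gr_form L) s v) =
  Z v - FPdim K (gr_form L (simple_root F s) v) * Z (simple_root F s).
Proof. by move=> [ZD ZM]; rewrite ZD HomZN // ZM. Qed.

(** Applies [gr_refl_unfold] letter by letter. Hence the group preserves the integral norm and maps
    unfolded roots to unfolded roots. *)
Lemma gr_act_unfold w : exists w', forall v,
  @unfold_actR _ _ _ _ L w' v = gr_act L w v.
Proof.
rewrite -(cox_reprK w); elim: (cox_repr w) => [|s l [w' IHl]].
  exists 1%g => v; rewrite (cox_action1 (unfold_actRP L)).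
  by rewrite (cox_act_word (gr_actP L)).
have [ws wsE] := gr_refl_unfold L s; exists (ws * w')%g => v.
rewrite (cox_actionM (unfold_actRP L)) wsE IHl.
by rewrite !(cox_act_word (gr_actP L)).
Qed.

Lemma znorm_gr_act w v : znorm L (gr_act L w v) = znorm L v.
Proof. by have [w' E] := gr_act_unfold w; rewrite -E znorm_unfold_actR. Qed.

(** A reflection changes a functional by a multiple of [FPdim] of the form against one simple root;
    these changes telescope along the word. The induction is on the last letter because [foldr]
    applies it first. *)
Lemma HomR_refl_span Z (l : seq S) : HomR Z -> exists y : S -> K, forall v,
  Z v - Z (foldr (gr_refl (gr_form L)) v l) =
  \sum_s y s * FPdim K (gr_form L (simple_root F s) v).
Proof.
move=> HZ; elim/last_ind: l => [|l t [y IHl]].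
  by exists (fun=> 0) => v /=; rewrite subrr big1 // => s _; rewrite mul0r.
pose Zl v := Z (foldr (gr_refl (gr_form L)) v l).
have HZl : HomR Zl.
  have := HomR_act (cox_word m l) HZ; congr HomR.
  by apply/funext => v; rewrite (cox_act_word (gr_actP L)).
exists (fun s => y s + (s == t)%:R * Zl (simple_root F s)) => v.
rewrite foldr_rcons -/(Zl _) HomR_refl // opprB addrCA [Z v - Zl v]IHl addrC.
under [RHS]eq_bigr do rewrite mulrDl.
rewrite big_split /=; congr (_ + _); rewrite (bigD1 t) //= eqxx mul1r mulrC.
by rewrite big1 ?addr0 // => s /negPf ->; rewrite !mul0r.
Qed.

(** * Averaging over the finite group *)

Section Finite.
Variable W : seq (coxGroup m).
Hypotheses (uW : uniq W) (inW : forall w, w \in W).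

Lemma sum_mulr (G : coxGroup m -> K) g :
  \sum_(w <- W) G (w * g)%g = \sum_(w <- W) G w.
Proof.
rewrite -(big_map (fun w => (w * g)%g) xpredT G); apply: perm_big.
apply: uniq_perm => //; first by rewrite map_inj_uniq //; apply: mulIg.
move=> w; rewrite inW; apply/mapP; exists (w * g^-1)%g => //.
by rewrite -mulgA mulVg mulg1.
Qed.

(** The sum is invariant under the group, while [s] negates its simple root; so it vanishes on
    simple roots, which determine it. *)
Lemma sum_HomR_act Z v : HomR Z -> \sum_(w <- W) Z (gr_act L w v) = 0.
Proof.
move=> HZ; pose N u := \sum_(w <- W) Z (gr_act L w u).
have HN : HomR N by apply: HomR_sum => w; apply: HomR_act.
rewrite -/(N v) (HomRE _ HN) big1 // => s _.
have E : N (gr_act L (cox_gen m s) (simple_root F s)) = N (simple_root F s).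
  rewrite /N -[RHS](sum_mulr _ (cox_gen m s)); apply: eq_bigr => w _.
  by rewrite (cox_actionM (gr_actP L)).
move: E; rewrite gr_act_gen gr_refl_root HomZN; last by case: HN.
by move=> E; rewrite (_ : N (simple_root F s) = 0) ?mulr0 //; lra.
Qed.

Hypothesis dM : FPdim_monoid K F.

Lemma HomR_comp s : HomR (fun v : RLambda F S => FPdim K (v s)).
Proof. by split=> [u v|a v]; rewrite ffunE ?FPdimD // (dM.2). Qed.

Definition height v := \sum_s FPdim K (v s).

Lemma HomR_height : HomR height.
Proof. by apply: HomR_sum => s; apply: HomR_comp. Qed.

Lemma height_root s : height (simple_root F s) = 1.
Proof.
rewrite /height (bigD1 s) //= ffunE eqxx dM.1 big1 ?addr0 // => t /negPf ts.
by rewrite ffunE ts FPdim0.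
Qed.

(** As heights sum to 0 over an orbit, [|W|] times the height of [v] is the sum of the differences
    [height v - height (w v)], which [HomR_refl_span] expands with coefficients [y]. Evaluation at
    simple roots, which have height 1, gives [c = |W|]. Positivity of [y] follows from [mmatrix_pos]
    for an invariant Gram matrix. *)
Lemma gr_r_pos_vector : exists (y : S -> K) (c : K),
  [/\ 0 < c, forall s, 0 < y s &
  forall t, \sum_s y s * FPdim K (gr_r L s t) = c].
Proof.
have [y yE] : exists y : S -> K, forall v, (size W)%:R * height v =
    \sum_s y s * FPdim K (gr_form L (simple_root F s) v).
  suff [y yE] : exists y : S -> K, forall v,
      \sum_(w <- W) (height v - height (gr_act L w v)) =
      \sum_s y s * FPdim K (gr_form L (simple_root F s) v).
    exists y => v; rewrite -yE sumrB (sum_HomR_act _ HomR_height) subr0.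
    by rewrite big_const_seq count_predT iter_addr_0 mulr_natl.
  elim: (W) => [|w l [y IHl]].
    by exists (fun=> 0) => v; rewrite big_nil big1 // => s _; rewrite mul0r.
  have [z zE] := HomR_refl_span (cox_repr w) HomR_height.
  exists (fun s => z s + y s) => v; rewrite big_cons IHl.
  rewrite -[w in gr_act L w]cox_reprK (cox_act_word (gr_actP L)) zE -big_split.
  by apply: eq_bigr => s _; rewrite mulrDl.
have W0 : 0 < (size W)%:R :> K by rewrite ltr0n; have := inW 1%g; case: (W).
(* The W-invariant form P satisfies 2 P(alpha_s, v) = P(alpha_s, alpha_s)
   FPdim B(alpha_s, v), so (P(alpha_s, alpha_t)) is a symmetrised FPdim (r_{s,t}). *)
pose P u v := \sum_(w <- W) \sum_k
  FPdim K (gr_act L w u k) * FPdim K (gr_act L w v k).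
pose al := @simple_root F S.
have HP u : HomR (P u).
  apply: HomR_sum => w; apply: HomR_sum => k.
  have [cD cM] := HomR_act w (HomR_comp k).
  by split=> [v v'|a v]; rewrite ?cD ?cM; ring.
have PN u v : P (- u) v = - P u v.
  rewrite /P -sumrN; apply: eq_bigr => w _; rewrite -sumrN; apply: eq_bigr => k _.
  by rewrite gr_actN ffunE FPdimN mulNr.
have P2 s v : P (al s) (al s) * FPdim K (gr_form L (al s) v) = 2 * P (al s) v.
  have : P (gr_refl (gr_form L) s (al s)) (gr_refl (gr_form L) s v) = P (al s) v.
    rewrite -!gr_act_gen /P -[RHS](sum_mulr _ (cox_gen m s)).
    by apply: eq_bigr => w _; rewrite !(cox_actionM (gr_actP L)).
  by rewrite gr_refl_root PN (HomR_refl _ _ (HP _)) -/(al s) => E; lra.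
have Ppos (x : S -> K) :
    \sum_s x s ^+ 2 <= \sum_s \sum_t x s * x t * P (al s) (al t).
  have -> : \sum_s \sum_t x s * x t * P (al s) (al t) =
      \sum_(w <- W) \sum_k (\sum_s x s * FPdim K (gr_act L w (al s) k)) ^+ 2.
    under eq_bigr do under eq_bigr do rewrite mulr_sumr.
    under eq_bigr do rewrite exchange_big.
    rewrite exchange_big /=; apply: eq_bigr => w _.
    under eq_bigr do under eq_bigr do rewrite mulr_sumr.
    under eq_bigr do rewrite exchange_big.
    rewrite exchange_big /=; apply: eq_bigr => k _.
    rewrite expr2 mulr_suml; apply: eq_bigr => s _; rewrite mulr_sumr.
    by apply: eq_bigr => t _; ring.
  (* The term of the identity is the sum of the squares [x s ^+ 2], and the other terms are
     nonnegative. *)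
  rewrite (bigD1_seq 1%g) //= [X in X + _](_ : _ = \sum_s x s ^+ 2).
    rewrite lerDl; apply: sumr_ge0 => w _; apply: sumr_ge0 => k _.
    by apply: sqr_ge0.
  apply: eq_bigr => k _; congr (_ ^+ 2).
  rewrite (bigD1 k) //= (cox_action1 (gr_actP L)) ffunE eqxx dM.1 mulr1.
  rewrite big1 ?addr0 // => s /negPf sk; rewrite (cox_action1 (gr_actP L)) ffunE eq_sym sk.
  by rewrite FPdim0 mulr0.
have Pdiag s : 0 < P (al s) (al s).
  have := Ppos (fun t => (t == s)%:R).
  rewrite (bigD1 s) //= eqxx expr1n big1 ?addr0; last first.
    by move=> t /negPf ->; rewrite expr0n.
  rewrite (bigD1 s) //= [X in _ + X]big1 ?addr0; last first.
    by move=> t /negPf ->; rewrite big1 // => k _; rewrite !mul0r.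
  rewrite (bigD1 s) //= eqxx [X in _ + X]big1 ?addr0 ?mul1r.
    exact: lt_le_trans.
  by move=> t /negPf ->; rewrite mulr0 mul0r.
have yc t : \sum_s y s * FPdim K (gr_r L s t) = (size W)%:R.
  by have := yE (simple_root F t); rewrite height_root mulr1 => ->.
exists y, (size W)%:R; split=> // s.
(* By [P2], this rescaling of [y] absorbs the passage from [FPdim (r_{s,t})] to the symmetric matrix
   [P (al s) (al t)]. *)
suff : 0 < 2 * y s / P (al s) (al s).
  by rewrite pmulr_lgt0 ?invr_gt0 // pmulr_rgt0.
move: s; apply: (@mmatrix_pos _ _ (fun s t => P (al s) (al t)) _ (size W)%:R) => //.
  move=> s t st; suff : 2 * P (al s) (al t) <= 0 by rewrite pmulr_rle0.
  rewrite -P2 pmulr_rle0 // -oppr_ge0 -FPdimN; apply: FPdim_ge0.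
  exact: gr_r_nonneg.
move=> t; rewrite -(yc t); apply: eq_bigr => s _.
apply: (mulfI (lt0r_neq0 (Pdiag s))).
rewrite [RHS]mulrCA -[gr_r L s t]/(gr_form L (al s) (al t)) P2.
by field; apply: lt0r_neq0.
Qed.

(** * Positive definiteness and vectors of norm 2 *)

(** By symmetry, the entries of row [(i, s)] at the indices [(j, t)], for fixed [t], are the
    coordinates of [b_i r_{t,s}]. Paired with [FPdim b_j * y t] and summed over [t], they give
    [FPdim b_i * c], which is positive, so [symmetric_posdef] applies. *)
Lemma zform_posdef (v : unfold_index F S -> int) : (exists x, v x != 0) ->
  0 < \sum_x \sum_y v x * unfold_r L x y * v y.
Proof.
move=> [k vk]; have [y [c [c0 y0 yc]]] := gr_r_pos_vector.
rewrite -(ltr0z K) rmorph_sum /=.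
under eq_bigr do rewrite rmorph_sum /=.
under eq_bigr do under eq_bigr do rewrite !rmorphM /=.
apply: (@symmetric_posdef _ _ (fun x z => (unfold_r L x z)%:~R)
  (fun x => FPdim K (fr_b x.1) * y x.2) (fun x => (v x)%:~R)).
- by move=> x z; rewrite unfold_r_sym.
- by move=> x z xz; rewrite lerz0 unfold_r_off.
- by move=> x; rewrite mulr_gt0 // FPdim_b_gt0.
- case=> i s; rewrite (_ : (\sum_j _) = FPdim K (fr_b i) * c).
    by rewrite mulr_gt0 // FPdim_b_gt0.
  rewrite -(yc s) mulr_sumr.
  rewrite [RHS](eq_bigr (fun t => \sum_j
    (unfold_r L (i, s) (j, t))%:~R * (FPdim K (fr_b j) * y t))).
    by rewrite exchange_big pair_bigA; apply: eq_bigr => -[].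
  move=> t _; rewrite mulrCA -dM.2 mulrC {1}/FPdim mulr_suml.
  apply: eq_bigr => j _; rewrite unfold_r_sym unfold_rE /= FPdim_b -mulrzr; ring.
- by exists k; rewrite intr_eq0.
Qed.

Lemma znorm2_sign v : znorm L v = 2 ->
  (forall x, 0 <= RtoZ v x) \/ (forall x, RtoZ v x <= 0).
Proof.
apply: norm2_sign => [x y|x|x y|u].
- exact: unfold_r_sym.
- exact: unfold_r_diag.
- exact: unfold_r_off.
- exact: zform_posdef.
Qed.

Lemma znorm2_neq0 v : znorm L v = 2 -> exists x, RtoZ v x != 0.
Proof.
move=> v2; apply: contrapT => /forallNP v0.
move: v2; rewrite /znorm /zform big1 // => x _; rewrite big1 // => y _.
by have /negP := v0 x; rewrite negbK => /eqP ->; rewrite !mul0r.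
Qed.

Lemma height_gt0 v x :
  (forall y, 0 <= RtoZ v y) -> RtoZ v x != 0 -> 0 < height v.
Proof.
move=> v0 vx; have vs s : 0 <= FPdim K (v s).
  by apply: FPdim_ge0 => i; have := v0 (i, s); rewrite ffunE.
rewrite /height (bigD1 x.2) //= ltr_wpDr ?sumr_ge0 //.
rewrite /FPdim (bigD1 x.1) //= ltr_wpDr //.
  apply: sumr_ge0 => i _; rewrite -mulrzr mulr_ge0 ?FPdim_basis_ge0 // ler0z.
  by have := v0 (i, x.2); rewrite ffunE.
rewrite -mulrzr mulr_gt0 // -?FPdim_b ?FPdim_b_gt0 // ltr0z.
by have := v0 x; rewrite le_eqVlt eq_sym (negPf vx) ffunE.
Qed.

(** The roots over a single [s] are pairwise orthogonal of norm 2, so the squares of the integer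
    coordinates sum to 1: one coordinate is 1 and the others vanish. *)
Lemma znorm2_simple s v : znorm L v = 2 -> (forall x, 0 <= RtoZ v x) ->
  (forall t, t != s -> v t = 0) -> exists i, v = zroot (i, s).
Proof.
move=> v2 v0 vs; set V := RtoZ v in v0.
have Vs x : x.2 != s -> V x = 0.
  by move=> xs; rewrite ffunE vs // fr_coord0.
have sumV : \sum_x V x ^+ 2 = 1.
  suff : znorm L v = 2 * \sum_x V x ^+ 2.
    by rewrite v2 => E; apply: (@mulfI _ 2); rewrite // -E mulr1.
  rewrite mulr_sumr; apply: eq_bigr => x _; rewrite (bigD1 x) //= big1 => [|y yx].
    by rewrite unfold_r_diag addr0 -/V; ring.
  rewrite -/V; have [xs|/Vs ->] := eqVneq x.2 s; last by rewrite !mul0r.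
  have [ys|/Vs ->] := eqVneq y.2 s; last by rewrite mulr0.
  by rewrite /unfold_r eq_sym (negPf yx) xs ys eqxx mulr0 mul0r.
have [x Vx] := znorm2_neq0 v2; rewrite -/V in Vx.
have rest0 : 0 <= \sum_(y | y != x) V y ^+ 2.
  by apply: sumr_ge0 => y _; apply: sqr_ge0.
move: sumV; rewrite (bigD1 x) //= => E.
have Vx1 : V x = 1.
  move: E rest0 Vx (v0 x); move: (V x) (\sum_(y | y != x) V y ^+ 2) => a r.
  by rewrite expr2; nia.
have /psumr_eq0P V0 : \sum_(y | y != x) V y ^+ 2 = 0.
  by move: E; rewrite Vx1 expr1n -[RHS]addr0 => /addrI.
exists x.1; have <- : x.2 = s by apply/eqP; apply: contraNT Vx => /Vs ->.
rewrite -surjective_pairing -[LHS]RtoZK -[RHS]RtoZK RtoZ_zroot; congr ZtoR.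
apply/ffunP => y; rewrite -/V [RHS]ffunE.
have [->|yx] := eqVneq y x; first exact: Vx1.
by apply/eqP; rewrite -sqrf_eq0 V0 // => z _; apply: sqr_ge0.
Qed.

(* Along [l], the first simple reflection that makes the vector negative only
   changes the coordinate of one simple root, so there the vector is [b alpha_s]. *)
Lemma znorm2_descent (l : seq S) v : znorm L v = 2 ->
  (forall x, 0 <= RtoZ v x) ->
  (forall x, RtoZ (foldr (gr_refl (gr_form L)) v l) x <= 0) ->
  exists i w s, v = fr_b i *: gr_act L w (simple_root F s).
Proof.
move=> v2 v0; elim: l => [|s l IHl] /= lv.
  by have [x] := znorm2_neq0 v2; rewrite eq_le v0 lv.
move: lv IHl; rewrite -(cox_act_word (gr_actP L)); set w := cox_word m l.
set u := gr_act L w v => ru IHl.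
have u2 : znorm L u = 2 by rewrite znorm_gr_act.
have [u0|/IHl//] := znorm2_sign u2.
have us t : t != s -> u t = 0.
  move=> ts; have uE : gr_refl (gr_form L) s u t = u t.
    by rewrite !ffunE (negPf ts) [_ *: _]mulr0 subr0.
  rewrite -(fr_coordK (u t)) big1 // => i _.
  have := ru (i, t); have := u0 (i, t); rewrite ffunE /= [in X in _ -> X]ffunE /= uE.
  by move=> h1 h2; rewrite (@le_anti _ _ (fr_coord (u t) i) 0) ?mulr0z // h2.
have [i ui] := znorm2_simple u2 u0 us.
exists i, w^-1%g, s; rewrite -gr_actZ -[_ *: _]/(zroot (i, s)) -ui.
by rewrite (cox_actK (gr_actP L)).
Qed.

(** If a nonnegative [v] were not of this form, [znorm2_descent] would keep its whole orbit from
    becoming nonpositive; all heights would then be positive, against [sum_HomR_act]. A nonpositive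
    [v] is treated through [- v], so [a] is a basis element up to sign. *)
Lemma znorm2_root v : znorm L v = 2 -> exists a w s,
  FPdim K a != 0 /\ v = a *: gr_act L w (simple_root F s).
Proof.
have pos u : znorm L u = 2 -> (forall x, 0 <= RtoZ u x) ->
    exists i w s, u = fr_b i *: gr_act L w (simple_root F s).
  move=> u2 u0; apply: contrapT => nu.
  have hu w : 0 < height (gr_act L w u).
    have wu2 : znorm L (gr_act L w u) = 2 by rewrite znorm_gr_act.
    have [x wux] := znorm2_neq0 wu2.
    have [wu0|] := znorm2_sign wu2; first exact: height_gt0 wu0 wux.
    rewrite -(cox_reprK w) (cox_act_word (gr_actP L)) => le0.
    by case: nu; apply: znorm2_descent u2 u0 le0.
  have := sum_HomR_act u HomR_height; rewrite (bigD1_seq 1%g) //=.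
  apply/eqP; rewrite gt_eqF // ltr_wpDr // sumr_ge0 // => w _.
  exact: ltW.
move=> v2; have [v0|v0] := znorm2_sign v2.
  have [i [w [s vE]]] := pos v v2 v0.
  by exists (fr_b i), w, s; split=> //; rewrite gt_eqF ?FPdim_b_gt0.
have [||i [w [s vE]]] := pos (- v).
- rewrite -v2 /znorm RtoZN; apply: eq_bigr => x _; apply: eq_bigr => y _.
  by rewrite !ffunE; ring.
- by move=> x; rewrite RtoZN ffunE oppr_ge0.
exists (- fr_b i), w, s; split; last by rewrite scaleNr -vE opprK.
by rewrite FPdimN oppr_eq0 gt_eqF ?FPdim_b_gt0.
Qed.

End Finite.
End HomR.

(** * Hyperplanes as annihilators of roots, and their comparison *)

Lemma fixed_inR (K : realType) (F : fusionRing) (S : finType)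
    (m : coxeterMatrix S) (L : geomRealisation K F m) w s :
  fixed_in (gr_act L) (@HomR K F S) (w * cox_gen m s * w^-1)%g =
  [set Z | HomR Z /\ Z (gr_act L w (simple_root F s)) = 0].
Proof.
apply/seteqP; split=> Z.
  move=> /(fixed_in_conj (gr_actP L)) [HZ ZE]; split=> //.
  have := ZE (simple_root F s); rewrite gr_refl_root gr_actN HomZN ?HZ.1 //.
    by lra.
  by case: HZ.
move=> [HZ Z0]; apply/(fixed_in_conj (gr_actP L)); split=> // v.
by rewrite (HomR_refl L s v (HomR_act L w HZ)) Z0 mulr0 subr0.
Qed.

Lemma fixed_inZ (K : realType) (F : fusionRing) (S : finType)
    (m : coxeterMatrix S) (L : geomRealisation K F m) w x :
  fixed_in (@unfold_actR K F S m L) (@HomZ K F S)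
    (w * cox_gen (unfold_cox L) x * w^-1)%g =
  [set Z | HomZ Z /\ Z (unfold_actR w (zroot x)) = 0].
Proof.
have ZwP (Z : RLambda F S -> K) : HomZ Z -> HomZ (Z \o unfold_actR w).
  by move=> ZD u v; rewrite /= unfold_actRD ZD.
have HomZM (Z : RLambda F S -> K) v k : HomZ Z -> Z (v *~ k) = Z v *~ k.
  move=> HZ; have ZMn n : Z (v *+ n) = Z v *+ n.
    by elim: n => [|n IHn]; rewrite ?mulr0n ?HomZ0 // !mulrS HZ IHn.
  by case: k => n; rewrite ?NegzE ?mulrNz ?HomZN // -!pmulrn ZMn.
have ZE (Z : RLambda F S -> K) v : HomZ Z ->
    Z (unfold_actR w (ZtoR (zrefl L x (RtoZ v)))) = Z (unfold_actR w v) -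
    Z (unfold_actR w (zroot x)) *~ fr_coord (gr_form L (simple_root F x.2) v) x.1.
  move=> /ZwP; rewrite zreflE -![Z (unfold_actR w _)]/((Z \o unfold_actR w) _).
  by move=> HZ; rewrite HZ HomZN // HomZM.
apply/seteqP; split=> Z.
  move=> /(fixed_in_conj (unfold_actRP L)) [HZ Zfix]; split=> //.
  have := Zfix (zroot x); rewrite ZE // -zform_gr_form RtoZ_zroot zform_roots.
  by rewrite unfold_r_diag -mulrzr => /=; lra.
move=> [HZ Z0]; apply/(fixed_in_conj (unfold_actRP L)); split=> // v.
by rewrite ZE // Z0 mul0rz subr0.
Qed.

Theorem corollary4p18 (K : realType) (S : finType) (m : coxeterMatrix S)
    (finW : finite_set [set: coxGroup m]) (F : fusionRing)
    (L : geomRealisation K F m) :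
  hyperplanesR L = [set H `&` @HomR K F S | H in hyperplanesZ L].
Proof.
have IE (v : RLambda F S) :
    [set Z : RLambda F S -> K | HomZ Z /\ Z v = 0] `&` @HomR K F S =
    [set Z | HomR Z /\ Z v = 0].
  by apply/seteqP; split=> Z [] => [[_ ?] ?|[? ?] ?].
apply/seteqP; split=> H.
  case=> -[w s] _ /= <-; rewrite fixed_inR.
  have [w' w'E] := gr_act_unfold L w.
  (* Since [b_1 = 1], the unfolded root at [(ord0, s)] is the simple root of [s] itself. *)
  eexists; first by exists (w', (ord0, s)).
  by rewrite /= fixed_inZ IE w'E /zroot fr_b1 scale1r.
move=> [_ [[w x] _ /= <-] <-]; rewrite fixed_inZ IE; set v := unfold_actR w _.
have v2 : znorm L v = 2 by rewrite znorm_unfold_actR znorm_zroot.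
(* Only the vanishing condition on [HomR] matters, so [v] may be replaced by a root that agrees with
   it up to a factor of nonzero [FPdim]. *)
suff [w' [s E]] : exists w' s, forall Z : RLambda F S -> K, HomR Z ->
    Z v = 0 <-> Z (gr_act L w' (simple_root F s)) = 0.
  exists (w', s) => //=; rewrite fixed_inR; apply/seteqP.
  by split=> Z [HZ /(E Z HZ) Z0].
have [[Z [HZ [u Zu]]]|triv] :=
    pselect (exists Z : RLambda F S -> K, HomR Z /\ exists u, Z u != 0).
  have dM := HomR_FPdim_monoid HZ Zu.
  have [W [uW inW]] : exists W : seq (coxGroup m), uniq W /\ forall w, w \in W.
    have /finite_seqP[W WE] := finW; exists (undup W); split; first exact: undup_uniq.
    move=> w'; rewrite mem_undup; have : [set: coxGroup m] w' by [].
    by rewrite WE.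
  have [a [w' [s [a0 vE]]]] := znorm2_root uW inW dM v2.
  exists w', s => Z' HZ'; rewrite vE HZ'.2; split=> [/eqP|->]; last exact: mulr0.
  by rewrite mulf_eq0 (negPf a0) => /eqP.
have Z0 (Z : RLambda F S -> K) u : HomR Z -> Z u = 0.
  move=> HZ; apply/eqP/negPn/negP => Zu; apply: triv.
  by exists Z; split=> //; exists u.
(* Here [HomR] contains only 0, so any choice of [w'] and [s] will do. *)
by exists 1%g, x.2 => Z HZ; rewrite !Z0.
Qed.
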